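(* Let $k\ge1$ and $c>0$. If there is a circuit $C$ of depth $d$ computing $\mathrm{CLIQUE}$ on $n$-vertex graphs, then for any set $U$ of $c\log^k n$ vertices there is a circuit $C'$ computing $\mathrm{CLIQUE}$ of depth $d+c\log^k n$ with orientation $\beta$ (i.e. $\beta$ is an orientation of the function computed at every gate of $C'$) such that $\beta_{e(u,v)}=0$ for every edge $e(u,v)$ with $u,v\in U$.
   Context: Circuits have $\land,\lor$ gates of fan-in at most two and $\neg$ gates. Inputs are indexed by edges $e(u,v)$ of the complete graph on $n$ vertices. A Boolean function $f:\{0,1\}^N\to\{0,1\}$ has orientation $\beta\in\{0,1\}^N$ if there is a monotone $h$ with $f(x)=h(x,x\oplus\beta)$ for all $x$. $\mathrm{CLIQUE}=\mathrm{CLIQUE}(n,n/2)$. *)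

(* Defs.v *)
From HB Require Import structures.
From mathcomp Require Import all_boot all_order all_algebra.
From mathcomp Require Import reals exp.

Set Implicit Arguments.
Unset Strict Implicit.
Unset Printing Implicit Defensive.

(* The input type [I] plays the role of the index set {1..N}, so that
   [{ffun I -> bool}] is {0,1}^N. *)

Definition monotone (I : finType) (h : {ffun I -> bool} -> bool) : Prop :=
  forall x y : {ffun I -> bool}, (forall i, x i -> y i) -> h x -> h y.

(* The concatenation (x, y) in {0,1}^(2N). *)
Definition cat_input (I : finType) (x y : {ffun I -> bool}) :
    {ffun I + I -> bool} :=
  [ffun j => match j with inl i => x i | inr i => y i end].

Definition xor_input (I : finType) (x b : {ffun I -> bool}) :
    {ffun I -> bool} :=
  [ffun i => x i (+) b i].

Definition has_orientation (I : finType) (f : {ffun I -> bool} -> bool)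
    (b : {ffun I -> bool}) : Prop :=
  exists h : {ffun I + I -> bool} -> bool,
    monotone h /\ forall x, f x = h (cat_input x (xor_input x b)).

(* Circuits are directed acyclic graphs, listed in topological order; wires
   are the positions of their source gates in the list.  Fan-in 0 is allowed:
   [And [::]] and [Or [::]] are the constants 1 and 0. *)
Inductive gate (I : Type) : Type :=
  | Input of I
  | Not of nat
  | And of seq nat
  | Or of seq nat.
Arguments And {I}.
Arguments Or {I}.
Arguments Not {I}.

Definition wires (I : Type) (g : gate I) : seq nat :=
  match g with
  | Input _ => [::]
  | Not j => [:: j]
  | And s => s
  | Or s => s
  end.

Record circuit (I : Type) : Type := Circuit {
  gates : seq (gate I);
  output : nat;
  output_lt : output < size gates;
  wires_ok : forall i, i < size gates ->
    let w := wires (nth (And [::]) gates i) in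
    size w <= 2 /\ all (fun j => j < i) w
}.

Definition gate_value (I : finType) (x : {ffun I -> bool}) (vs : seq bool)
    (g : gate I) : bool :=
  match g with
  | Input i => x i
  | Not j => ~~ nth false vs j
  | And s => all (nth false vs) s
  | Or s => has (nth false vs) s
  end.

Definition gate_values (I : finType) (x : {ffun I -> bool})
    (gs : seq (gate I)) : seq bool :=
  foldl (fun vs g => rcons vs (gate_value x vs g)) [::] gs.

Definition gate_fun (I : finType) (C : circuit I) (i : nat)
    (x : {ffun I -> bool}) : bool :=
  nth false (gate_values x (gates C)) i.

Definition computes (I : finType) (C : circuit I)
    (f : {ffun I -> bool} -> bool) : Prop :=
  forall x, gate_fun C (output C) x = f x.

(* Length of a longest path ending in the gate; negations are counted, and
   sources (inputs and constants) have depth 0. *)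
Definition gate_depth (I : Type) (ds : seq nat) (g : gate I) : nat :=
  \max_(j <- wires g) (nth 0 ds j).+1.

Definition gate_depths (I : Type) (gs : seq (gate I)) : seq nat :=
  foldl (fun ds g => rcons ds (gate_depth ds g)) [::] gs.

Definition depth (I : Type) (C : circuit I) : nat :=
  nth 0 (gate_depths (gates C)) (output C).

Definition circuit_orientation (I : finType) (C : circuit I)
    (b : {ffun I -> bool}) : Prop :=
  forall i, i < size (gates C) -> has_orientation (gate_fun C i) b.

Definition edge (n : nat) : finType := {e : {set 'I_n} | #|e| == 2}.

Lemma edge_proof (n : nat) (u v : 'I_n) : u != v -> #|[set u; v]| == 2.
Proof. by rewrite cards2 => ->. Qed.

Definition edge_of (n : nat) (u v : 'I_n) (uv : u != v) : edge n :=
  exist _ [set u; v] (edge_proof uv).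

Definition is_clique (n : nat) (x : {ffun edge n -> bool}) (Q : {set 'I_n}) :
    bool :=
  [forall e : edge n, (val e \subset Q) ==> x e].

Definition CLIQUE_size (n s : nat) (x : {ffun edge n -> bool}) : bool :=
  [exists Q : {set 'I_n}, (#|Q| == s) && is_clique x Q].

(* CLIQUE(n, n/2), with n/2 rounded down when n is odd. *)
Definition CLIQUE (n : nat) : {ffun edge n -> bool} -> bool :=
  @CLIQUE_size n n./2.

Local Open Scope ring_scope.

(* c log^k n, rounded down to an integer; the logarithm is in base 2. *)
Definition polylog (R : realType) (c k : R) (n : nat) : nat :=
  Num.truncn (c * (ln (n%:R : R) / ln 2) `^ k).

(* Main.v *)
(* Push the negations of C to its inputs; this does not increase the depth.
   For S a subset of U, let D_S be the result of replacing, for every edge e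
   inside U, the literal "not e" by 0 and keeping "e" when e lies inside S, and
   replacing "not e" by 1 and "e" by 0 otherwise.  Each D_S is monotone in the
   edges inside U.  Since D_S(x) <= C(x') for the graph x' obtained from x by
   deleting the edges inside U but not inside S, and CLIQUE is monotone,
   D_S <= CLIQUE.  Conversely, if Q is a clique of x of size n/2 and S is the
   intersection of Q and U, then D_S(x) = C(x') = 1.  So CLIQUE is the
   disjunction of the 2^|U| functions D_S, which costs |U| further levels. *)

Require Import Defs.
From mathcomp Require Import all_boot all_order all_algebra.
From mathcomp Require Import reals exp.

Set Implicit Arguments.
Unset Strict Implicit.
Unset Printing Implicit Defensive.

(** * Closure properties of functions with a fixed orientation *)

Section Orientation.
Variables (I : finType) (b : {ffun I -> bool}).
Implicit Types (x : {ffun I -> bool}) (f g : {ffun I -> bool} -> bool).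

Lemma eq_orientation f g : f =1 g -> has_orientation f b -> has_orientation g b.
Proof. by move=> fg [h [mh fE]]; exists h; split=> // x; rewrite -fg. Qed.

Lemma orientation_const a : has_orientation (fun=> a) b.
Proof. by exists (fun=> a); split. Qed.

Lemma orientation_input i : has_orientation (fun x => x i) b.
Proof.
exists (fun z => z (inl i)); split=> [z t|x]; first exact.
by rewrite ffunE.
Qed.

Lemma orientation_neg i : b i -> has_orientation (fun x => ~~ x i) b.
Proof.
move=> bi; exists (fun z => z (inr i)); split=> [z t|x]; first exact.
by rewrite !ffunE bi addbT.
Qed.

Lemma orientation_and f g : has_orientation f b -> has_orientation g b ->
  has_orientation (fun x => f x && g x) b.
Proof.
move=> [h [mh fE]] [k [mk gE]]; exists (fun z => h z && k z); split=> [z t zt|x].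
  by case/andP=> /(mh _ _ zt)-> /(mk _ _ zt)->.
by rewrite fE gE.
Qed.

Lemma orientation_or f g : has_orientation f b -> has_orientation g b ->
  has_orientation (fun x => f x || g x) b.
Proof.
move=> [h [mh fE]] [k [mk gE]]; exists (fun z => h z || k z); split=> [z t zt|x].
  by case/orP=> [/(mh _ _ zt)-> | /(mk _ _ zt)->]; rewrite ?orbT.
by rewrite fE gE.
Qed.

End Orientation.

(** * Gatewise evaluation of circuits, and juxtaposition of two circuits *)

Section Evaluation.
Variable I : finType.
Implicit Types (x : {ffun I -> bool}) (gs hs : seq (gate I)) (g : gate I).

Lemma gate_values_rcons x gs g :
  gate_values x (rcons gs g) =
  rcons (gate_values x gs) (gate_value x (gate_values x gs) g).
Proof. by rewrite /gate_values foldl_rcons. Qed.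

Lemma gate_depths_rcons gs g :
  gate_depths (rcons gs g) =
  rcons (gate_depths gs) (gate_depth (gate_depths gs) g).
Proof. by rewrite /gate_depths foldl_rcons. Qed.

Lemma size_gate_values x gs : size (gate_values x gs) = size gs.
Proof.
by elim/last_ind: gs => // gs g IH; rewrite gate_values_rcons !size_rcons IH.
Qed.

Lemma size_gate_depths gs : size (gate_depths gs) = size gs.
Proof.
by elim/last_ind: gs => // gs g IH; rewrite gate_depths_rcons !size_rcons IH.
Qed.

Lemma eq_gate_value x vs ws g : {in wires g, nth false vs =1 nth false ws} ->
  gate_value x vs g = gate_value x ws g.
Proof.
case: g => [i|j|s|s] //= E; first by rewrite E ?mem_head.
- exact: eq_in_all.
- exact: eq_in_has.
Qed.

Lemma eq_gate_depth ds es g : {in wires g, nth 0 ds =1 nth 0 es} ->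
  gate_depth ds g = gate_depth es g.
Proof. by move=> E; apply: eq_big_seq => j /E->. Qed.

(** Appending gates never changes earlier values, and wires point backwards, so the prefix seen when
    a gate was evaluated can be replaced by the final list. *)
Lemma nth_gate_values x gs i : i < size gs ->
    all (fun j => j < i) (wires (nth (And [::]) gs i)) ->
  nth false (gate_values x gs) i =
  gate_value x (gate_values x gs) (nth (And [::]) gs i).
Proof.
elim/last_ind: gs => // gs g IH; rewrite size_rcons ltnS gate_values_rcons => le_i.
have E k : k < size gs ->
    nth false (rcons (gate_values x gs)
                     (gate_value x (gate_values x gs) g)) k =
    nth false (gate_values x gs) k.
  by move=> lt_k; rewrite nth_rcons size_gate_values lt_k.
rewrite nth_rcons; case: ltngtP le_i => // [lt_i|->] _ /allP ok.
  rewrite E // IH //; last exact/allP.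
  by apply: eq_gate_value => j /ok lt_j; rewrite E // (ltn_trans lt_j).
rewrite nth_rcons size_gate_values ltnn eqxx.
by apply: eq_gate_value => j /ok /E->.
Qed.

Lemma nth_gate_depths gs i : i < size gs ->
    all (fun j => j < i) (wires (nth (And [::]) gs i)) ->
  nth 0 (gate_depths gs) i = gate_depth (gate_depths gs) (nth (And [::]) gs i).
Proof.
elim/last_ind: gs => // gs g IH; rewrite size_rcons ltnS gate_depths_rcons => le_i.
have E k : k < size gs ->
    nth 0 (rcons (gate_depths gs) (gate_depth (gate_depths gs) g)) k =
    nth 0 (gate_depths gs) k.
  by move=> lt_k; rewrite nth_rcons size_gate_depths lt_k.
rewrite nth_rcons; case: ltngtP le_i => // [lt_i|->] _ /allP ok.
  rewrite E // IH //; last exact/allP.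
  by apply: eq_gate_depth => j /ok lt_j; rewrite E // (ltn_trans lt_j).
rewrite nth_rcons size_gate_depths ltnn eqxx.
by apply: eq_gate_depth => j /ok /E->.
Qed.

Definition shift_gate (k : nat) (g : gate I) : gate I :=
  match g with
  | Input i => Input i
  | Not j => Not (k + j)
  | And s => And (map (addn k) s)
  | Or s => Or (map (addn k) s)
  end.

Lemma wires_shift_gate k g : wires (shift_gate k g) = map (addn k) (wires g).
Proof. by case: g. Qed.

Lemma gate_values_cat x gs hs :
  gate_values x (gs ++ map (shift_gate (size gs)) hs) =
  gate_values x gs ++ gate_values x hs.
Proof.
elim/last_ind: hs => [|hs h IH]; first by rewrite !cats0.
rewrite map_rcons -rcons_cat !gate_values_rcons IH -rcons_cat; congr rcons.
have E j : nth false (gate_values x gs ++ gate_values x hs) (size gs + j) =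
           nth false (gate_values x hs) j.
  by rewrite nth_cat size_gate_values ltnNge leq_addr addKn.
case: h => [i|j|s|s] //=; first by rewrite E.
- by rewrite all_map; apply: eq_all.
- by rewrite has_map; apply: eq_has.
Qed.

Lemma gate_depths_cat gs hs :
  gate_depths (gs ++ map (shift_gate (size gs)) hs) =
  gate_depths gs ++ gate_depths hs.
Proof.
elim/last_ind: hs => [|hs h IH]; first by rewrite !cats0.
rewrite map_rcons -rcons_cat !gate_depths_rcons IH -rcons_cat; congr rcons.
rewrite /gate_depth wires_shift_gate big_map; apply: eq_bigr => j _.
by rewrite nth_cat size_gate_depths ltnNge leq_addr addKn.
Qed.

End Evaluation.

(** * Functions with circuits of bounded depth and given orientation *)

Section Realizable.
Variables (I : finType) (b : {ffun I -> bool}).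
Implicit Types (x : {ffun I -> bool}) (f g : {ffun I -> bool} -> bool).

Definition realizable f (d : nat) : Prop :=
  exists C : circuit I,
    [/\ computes C f, depth C <= d & circuit_orientation C b].

Lemma realizable_ext f g d : f =1 g -> realizable f d -> realizable g d.
Proof. by move=> fg [C [cC dC oC]]; exists C; split=> // x; rewrite -fg. Qed.

Lemma realizable_le f d e : d <= e -> realizable f d -> realizable f e.
Proof. by move=> de [C [? dC ?]]; exists C; split=> //; apply: leq_trans de. Qed.

Lemma realizable_source (g : gate I) d : wires g = [::] ->
    has_orientation (fun x => gate_value x [::] g) b ->
  realizable (fun x => gate_value x [::] g) d.
Proof.
move=> wg og.
have ok i : i < size [:: g] -> let w := wires (nth (And [::]) [:: g] i) in
    size w <= 2 /\ all (fun j => j < i) w.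
  by case: i => //= _; rewrite wg.
exists (@Circuit _ [:: g] 0 isT ok); split=> //.
  by rewrite /depth /= /gate_depth wg big_nil.
by case.
Qed.

Lemma realizable_const a d : realizable (fun=> a) d.
Proof.
case: a; [apply: (@realizable_source (And [::])) |
          apply: (@realizable_source (Or [::]))] => //; exact: orientation_const.
Qed.

Lemma realizable_input i d : realizable (fun x => x i) d.
Proof. apply: (@realizable_source (Input i)) => //; exact: orientation_input. Qed.

Lemma realizable_neg i d : b i -> realizable (fun x => ~~ x i) d.+1.
Proof.
move=> bi.
pose gs : seq (gate I) := [:: Input i; Not 0].
have ok j : j < size gs -> let w := wires (nth (And [::]) gs j) in
    size w <= 2 /\ all (fun k => k < j) w.
  by case: j => [|[]].
exists (@Circuit _ gs 1 isT ok); split=> //.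
  by rewrite /depth /= /gate_depth /= big_nil big_seq1.
by case=> [|[|//]] _; [apply: orientation_input | apply: orientation_neg].
Qed.

(** A boolean selects the connective, so that both are treated at once and De Morgan duality becomes
    negation of [conj]. *)
Definition binary_gate (conj : bool) (j k : nat) : gate I :=
  if conj then And [:: j; k] else Or [:: j; k].

Definition binary_fun (conj : bool) (u v : bool) : bool :=
  if conj then u && v else u || v.

Lemma gate_value_binary x vs conj j k :
  gate_value x vs (binary_gate conj j k) =
  binary_fun conj (nth false vs j) (nth false vs k).
Proof. by case: conj; rewrite /= ?andbT ?orbF. Qed.

Lemma wires_binary_gate conj j k : wires (binary_gate conj j k) = [:: j; k].
Proof. by case: conj. Qed.

Lemma orientation_binary conj f g :
  has_orientation f b -> has_orientation g b ->
  has_orientation (fun x => binary_fun conj (f x) (g x)) b.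
Proof. by case: conj; [apply: orientation_and | apply: orientation_or]. Qed.

(** The two gate lists are juxtaposed, the second with shifted wires, and one gate joins the
    outputs. Old gates keep their functions, hence their orientation. *)
Lemma realizable_binary conj f g d : realizable f d -> realizable g d ->
  realizable (fun x => binary_fun conj (f x) (g x)) d.+1.
Proof.
move=> [C1 [c1 d1 o1]] [C2 [c2 d2 o2]].
pose gs1 := gates C1; pose gs2 := gates C2; pose k := size gs1.
pose hs := gs1 ++ map (shift_gate k) gs2.
pose top := binary_gate conj (output C1) (k + output C2).
have szh : size hs = k + size gs2 by rewrite size_cat size_map.
have lt1 : output C1 < k by exact: output_lt.
have lt2 : output C2 < size gs2 by exact: output_lt.
have ok i : i < size (rcons hs top) ->
    let w := wires (nth (And [::]) (rcons hs top) i) in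
    size w <= 2 /\ all (fun j => j < i) w.
  rewrite size_rcons ltnS nth_rcons => le_i.
  case: ltngtP le_i => // [lt_i|->] _; last first.
    by rewrite wires_binary_gate /= szh ltn_add2l lt2 (leq_trans lt1) ?leq_addr.
  rewrite nth_cat -/k; case: ltnP => [lt_ik|le_ki]; first exact: wires_ok.
  have lt_i2 : i - k < size gs2 by rewrite ltn_subLR // -szh.
  rewrite (nth_map (And [::])) // wires_shift_gate /= size_map all_map.
  have [sz /allP lt_w] := wires_ok lt_i2; split=> //.
  by apply/allP => j /lt_w /=; rewrite -(ltn_add2l k) subnKC.
have ltout : size hs < size (rcons hs top) by rewrite size_rcons.
pose D := Circuit ltout ok.
have vals x : gate_values x (rcons hs top) =
    rcons (gate_values x gs1 ++ gate_values x gs2) (binary_fun conj (f x) (g x)).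
  rewrite gate_values_rcons gate_values_cat gate_value_binary; congr rcons.
  rewrite !nth_cat size_gate_values lt1 ltnNge leq_addr /= addKn.
  by rewrite -[f x]c1 -[g x]c2.
have szv x : size (gate_values x gs1 ++ gate_values x gs2) = size hs.
  by rewrite size_cat !size_gate_values szh.
exists D; split=> [x||i].
- by rewrite /gate_fun /= vals nth_rcons szv ltnn eqxx.
- rewrite /depth /= gate_depths_rcons gate_depths_cat nth_rcons.
  rewrite size_cat !size_gate_depths szh ltnn eqxx.
  rewrite /gate_depth wires_binary_gate big_cons big_seq1 geq_max !ltnS.
  by rewrite !nth_cat size_gate_depths lt1 ltnNge leq_addr /= addKn d1 d2.
rewrite /= size_rcons ltnS => le_i.
case: (ltngtP i (size hs)) le_i => // [lt_i|->] _; last first.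
  apply: (eq_orientation (f := fun x => binary_fun conj (f x) (g x))) => [x|].
    by rewrite /gate_fun /= vals nth_rcons szv ltnn eqxx.
  by apply: orientation_binary;
    [apply: eq_orientation c1 _; apply: o1 | apply: eq_orientation c2 _; apply: o2].
case: (ltnP i k) => [lt_ik|le_ki].
  apply: (eq_orientation (f := gate_fun C1 i)) (o1 _ lt_ik) => x.
  by rewrite /gate_fun /= vals nth_rcons szv lt_i nth_cat size_gate_values lt_ik.
have lt_i2 : i - k < size gs2 by rewrite ltn_subLR // -szh.
apply: (eq_orientation (f := gate_fun C2 (i - k))) (o2 _ lt_i2) => x.
rewrite /gate_fun /= vals nth_rcons szv lt_i nth_cat size_gate_values.
by rewrite ltnNge le_ki.
Qed.

(** A balanced binary tree of disjunctions: each halving of the list costs one level. *)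
Lemma realizable_has (T : Type) (F : T -> {ffun I -> bool} -> bool) d m
    (s : seq T) : size s <= 2 ^ m -> (forall t, realizable (F t) d) ->
  realizable (fun x => has (F^~ x) s) (d + m).
Proof.
move=> + rF; elim: m s => [|m IH] s.
  case: s => [|t [|//]] _ /=; first exact: realizable_const.
  rewrite addn0; apply: realizable_ext (rF t) => x.
  by rewrite orbF.
rewrite expnS mul2n -addnn => sz; rewrite addnS.
have r1 : realizable (fun x => has (F^~ x) (take (2 ^ m) s)) (d + m).
  by apply: IH; rewrite size_take; case: ltnP.
have r2 : realizable (fun x => has (F^~ x) (drop (2 ^ m) s)) (d + m).
  by apply: IH; rewrite size_drop leq_subLR.
apply: realizable_ext (realizable_binary false r1 r2) => x /=.
by rewrite -has_cat cat_take_drop.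
Qed.

End Realizable.

(** * Oriented approximations of a circuit on restricted inputs *)

Section Restriction.
Variables (I : finType) (b : {ffun I -> bool}) (A : {set I}).
Implicit Type x : {ffun I -> bool}.

(** In the application [b] marks the edges not inside [U] and [A] the edges inside [S], so this is
    the graph with the edges inside [U] but not inside [S] deleted. *)
Definition restrict_input x : {ffun I -> bool} :=
  [ffun i => x i && (b i || (i \in A))].

(** For [S] a subset of [U], this says that [S] is a clique of [x]. *)
Definition full_input x : Prop := forall i, ~~ b i -> i \in A -> x i.

(** The one-sided bound gives soundness of each disjunct; equality on full inputs gives
    completeness. Both survive monotone connectives. *)
Definition approximates (p f : {ffun I -> bool} -> bool) : Prop :=
  forall x, (p x -> f (restrict_input x)) /\
            (full_input x -> p x = f (restrict_input x)).

Lemma approximates_binary conj p q f g :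
  approximates p f -> approximates q g ->
  approximates (fun x => binary_fun conj (p x) (q x))
               (fun x => binary_fun conj (f x) (g x)).
Proof.
move=> pf qg x; have [pf1 pf2] := pf x; have [qg1 qg2] := qg x.
split=> [|fx]; last by rewrite pf2 ?qg2.
case: conj => /=; first by case/andP=> /pf1-> /qg1->.
by case/orP=> [/pf1-> | /qg1->]; rewrite ?orbT.
Qed.

(* [p] approximates [f] and [q] approximates the negation of [f].  The extra
   level for [q] pays for a negated input; a Not gate of the original circuit
   has one level more than its argument, so swapping [p] and [q] costs
   nothing. *)
Definition dual_rail (f : {ffun I -> bool} -> bool) (d : nat) : Prop :=
  (exists2 p, realizable b p d & approximates p f) /\
  (exists2 q, realizable b q d.+1 & approximates q (fun x => ~~ f x)).

Lemma dual_rail_ext f g d : f =1 g -> dual_rail f d -> dual_rail g d.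
Proof.
move=> fg [[p rp ap] [q rq aq]].
by split; [exists p | exists q] => // x; rewrite -fg; [apply: ap | apply: aq].
Qed.

Lemma dual_rail_le f d e : d <= e -> dual_rail f d -> dual_rail f e.
Proof.
move=> de [[p rp ap] [q rq aq]].
split; [exists p => // | exists q => //]; last by apply: realizable_le rq.
exact: realizable_le rp.
Qed.

Lemma dual_rail_const a d : dual_rail (fun=> a) d.
Proof.
by split; [exists (fun=> a) | exists (fun=> ~~ a)] => //; apply: realizable_const.
Qed.

Lemma dual_rail_input i d : dual_rail (fun x => x i) d.
Proof.
(* The restriction leaves this coordinate alone, and the orientation allows both of its literals. *)
case bi: (b i).
  split; [exists (fun x => x i) | exists (fun x => ~~ x i)].
  - exact: realizable_input.
  - by move=> x; rewrite ffunE bi andbT.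
  - exact: realizable_neg.
  - by move=> x; rewrite ffunE bi andbT.
(* The negated literal becomes 0: always a lower bound, and exact when the input is full. The other
   substitutions are exact on every input. *)
case Ai: (i \in A).
  split; [exists (fun x => x i) | exists (fun=> false)].
  - exact: realizable_input.
  - by move=> x; rewrite ffunE Ai orbT andbT.
  - exact: realizable_const.
  - by move=> x; split=> // fx; rewrite ffunE Ai orbT andbT fx ?bi.
(* The restriction sets this coordinate to 0, so both literals are constants. *)
split; [exists (fun=> false) | exists (fun=> true)].
- exact: realizable_const.
- by move=> x; rewrite ffunE bi Ai andbF.
- exact: realizable_const.
- by move=> x; rewrite ffunE bi Ai andbF.
Qed.

Lemma dual_rail_not f d : dual_rail f d -> dual_rail (fun x => ~~ f x) d.+1.
Proof.
move=> [[p rp ap] [q rq aq]]; split; first by exists q.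
exists p; first by apply: realizable_le rp; rewrite -addn2 leq_addr.
by move=> x; rewrite negbK; apply: ap.
Qed.

Lemma dual_rail_binary conj f g d : dual_rail f d -> dual_rail g d ->
  dual_rail (fun x => binary_fun conj (f x) (g x)) d.+1.
Proof.
move=> [[p rp ap] [q rq aq]] [[p' rp' ap'] [q' rq' aq']]; split.
  exists (fun x => binary_fun conj (p x) (p' x)).
    exact: realizable_binary.
  exact: approximates_binary.
(* De Morgan: the negative rail uses the opposite connective. *)
exists (fun x => binary_fun (~~ conj) (q x) (q' x)).
  exact: realizable_binary.
move=> x; have := approximates_binary (~~ conj) aq aq' x.
by case: conj; rewrite /= ?negb_and ?negb_or.
Qed.

(** Strong induction on the position of the gate, since its wires lead to smaller positions. *)
Lemma dual_rail_gate (C : circuit I) i : i < size (gates C) ->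
  dual_rail (gate_fun C i) (nth 0 (gate_depths (gates C)) i).
Proof.
elim/ltn_ind: i => i IH lt_i; have [sz ok] := wires_ok lt_i.
pose g := nth (And [::]) (gates C) i.
apply: (@dual_rail_ext (fun x => gate_value x (gate_values x (gates C)) g)).
  by move=> x; rewrite /gate_fun nth_gate_values.
rewrite nth_gate_depths //.
have {}IH j : j \in wires g ->
    dual_rail (gate_fun C j) (nth 0 (gate_depths (gates C)) j).
  by move=> /(allP ok) lt_j; apply: IH => //; apply: ltn_trans lt_i.
rewrite -/g /gate_depth; move: sz IH {ok}; rewrite -/g; case: g => [e|j|s|s] /=.
- by move=> _ _; apply: dual_rail_input.
- move=> _ IH; rewrite big_seq1; apply: dual_rail_not.
  by apply: IH; rewrite mem_head.
- case: s => [|j [|k [|//]]] _ IH; first exact: dual_rail_const.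
    (* A conjunction of fan-in one is the identity, so the rails of its argument serve, with a level
       to spare. *)
    rewrite big_seq1 /=; apply: dual_rail_le (leqnSn _) _.
    apply: dual_rail_ext (IH j _); last exact: mem_head.
    by move=> x; rewrite andbT.
  rewrite big_cons big_seq1 maxnSS /=.
  have := @dual_rail_binary true (gate_fun C j) (gate_fun C k).
  move=> /(_ _ (dual_rail_le (leq_maxl _ _) (IH j _))
               (dual_rail_le (leq_maxr _ _) (IH k _))).
  rewrite !inE !eqxx orbT => /(_ isT isT); apply: dual_rail_ext => x.
  by rewrite /= andbT.
- case: s => [|j [|k [|//]]] _ IH; first exact: dual_rail_const.
    rewrite big_seq1 /=; apply: dual_rail_le (leqnSn _) _.
    apply: dual_rail_ext (IH j _); last exact: mem_head.
    by move=> x; rewrite orbF.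
  rewrite big_cons big_seq1 maxnSS /=.
  have := @dual_rail_binary false (gate_fun C j) (gate_fun C k).
  move=> /(_ _ (dual_rail_le (leq_maxl _ _) (IH j _))
               (dual_rail_le (leq_maxr _ _) (IH k _))).
  rewrite !inE !eqxx orbT => /(_ isT isT); apply: dual_rail_ext => x.
  by rewrite /= orbF.
Qed.

Lemma approximation_exists (C : circuit I) f d :
    computes C f -> depth C <= d ->
  exists p, realizable b p d /\ approximates p f.
Proof.
move=> cC dC; have [[p rp ap] _] := dual_rail_gate (output_lt C).
exists p; split; first exact: realizable_le rp.
by move=> x; rewrite -cC; apply: ap.
Qed.

End Restriction.

(** * Application to CLIQUE *)

Lemma CLIQUE_monotone n : monotone (@CLIQUE n).
Proof.
move=> x y xy /existsP [Q /andP [sQ /forallP cQ]].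
apply/existsP; exists Q; rewrite sQ; apply/forallP => e; apply/implyP => eQ.
by apply: xy; apply: (implyP (cQ e)).
Qed.

Theorem theorem7 (R : realType) (k c : R) (hk : (1 <= k)%R) (hc : (0 < c)%R)
    (n d : nat) (C : circuit (edge n))
    (hC : computes C (@CLIQUE n)) (hd : depth C <= d)
    (U : {set 'I_n}) (hU : #|U| = polylog c k n) :
  exists (C' : circuit (edge n)) (beta : {ffun edge n -> bool}),
    [/\ computes C' (@CLIQUE n),
        depth C' <= d + polylog c k n,
        circuit_orientation C' beta
      & forall (u v : 'I_n) (huv : u != v),
          u \in U -> v \in U -> beta (edge_of huv) = false].
Proof.
pose beta : {ffun edge n -> bool} := [ffun e : edge n => ~~ (val e \subset U)].
pose A (S : {set 'I_n}) : {set edge n} := [set e : edge n | val e \subset S].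
(* A choice of one approximation [D S] for each of the finitely many vertex sets [S]; only the
   subsets of [U] enter the disjunction. *)
have [D DP] := fin_all_exists
  (fun S : {set 'I_n} => approximation_exists beta (A S) hC hd).
have szU : size (enum (powerset U)) <= 2 ^ #|U| by rewrite -cardE card_powerset.
have := realizable_has szU (fun S => (DP S).1); rewrite hU => - [C' [cC dC oC]].
exists C', beta; split=> // [x|u v uv uU vU]; last first.
  by rewrite ffunE /= subUset !sub1set uU vU.
(* Soundness: [D S] accepts only if the restricted graph has a large clique, and that graph is a
   subgraph of [x]. *)
rewrite cC; apply/hasP/idP => [[S _ DSx] | clx].
  by apply: CLIQUE_monotone (((DP S).2 x).1 DSx) => e; rewrite ffunE => /andP [].
have /existsP [Q /andP [sQ /forallP cQ]] := clx.
exists (Q :&: U); first by rewrite mem_enum powersetE subsetIr.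
(* The input is full for this [S], since every edge inside [Q :&: U] lies inside the clique [Q]. *)
rewrite (((DP (Q :&: U)).2 x).2) => [|e _]; last first.
  by rewrite inE subsetI => /andP [eQ _]; apply: (implyP (cQ e)).
(* [Q] stays a clique after the deletion: an edge inside both [Q] and [U] lies inside [Q :&: U] and
   is kept. *)
apply/existsP; exists Q; rewrite sQ; apply/forallP => e; apply/implyP => eQ.
by rewrite !ffunE inE subsetI eQ orNb andbT; apply: (implyP (cQ e)).
Qed.
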